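(* Let $q \equiv 3 \pmod{4}$ be a prime power. Then $$\mathcal{K}_4(G_2(q)) = \frac{q(q-1)(q-3)(q-7)}{2^6}.$$
   Context: $G_2(q)$ is the Paley tournament of order $q$: the digraph with vertex set the finite field $\mathbb{F}_q$ where $a \to b$ is an edge if and only if $b-a$ is a nonzero square in $\mathbb{F}_q$. For a digraph $G$, $\mathcal{K}_m(G)$ is the number of transitive subtournaments of order $m$ contained in $G$; a tournament of order $m$ is transitive if its vertices can be listed $a_1,\dots,a_m$ with $a_i \to a_j$ for all $i<j$. *)

(* Defs.v *)
From mathcomp Require Import all_boot all_order all_algebra.

Set Implicit Arguments.
Unset Strict Implicit.
Unset Printing Implicit Defensive.

Import GRing.Theory.
Local Open Scope ring_scope.

Section Digraphs.
Variable T : finType.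
Implicit Types (V : {set T}) (E : {set T * T}).

Definition is_tournament V E : bool :=
  [&& E \subset setX V V,
      [forall x in V, (x, x) \notin E] &
      [forall x in V, forall y in V,
         (x != y) ==> (((x, y) \in E) (+) ((y, x) \in E))]].

(* A surjective listing of V by #|V| entries is automatically duplicate-free. *)
Definition is_transitive V E : bool :=
  [exists a : #|V|.-tuple T,
     ([set:: a] == V) &&
     [forall i : 'I_#|V|, forall j : 'I_#|V|,
        (i < j)%N ==> ((tnth a i, tnth a j) \in E)]].

(* Subtournaments are subdigraphs (V, E), not just vertex sets: the two notions
   give the same count when G has no 2-cycles, but differ in general. *)
Definition transitive_subtournaments (m : nat) (G : rel T) :
    {set {set T} * {set T * T}} :=
  [set H : {set T} * {set T * T} |
    [&& #|H.1| == m,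
        H.2 \subset [set xy : T * T | G xy.1 xy.2],
        is_tournament H.1 H.2 &
        is_transitive H.1 H.2]].

Definition num_transitive_subtournaments (m : nat) (G : rel T) : nat :=
  #|transitive_subtournaments m G|.

End Digraphs.

Definition nonzero_square (F : finFieldType) (x : F) : bool :=
  (x != 0) && [exists y : F, x == y ^+ 2].

Definition paley (F : finFieldType) : rel F :=
  fun a b => nonzero_square (b - a).

(* Main.v *)
Require Import Defs.
From mathcomp Require Import all_boot all_order all_algebra.
From mathcomp Require Import finfield zify lra.

Set Implicit Arguments.
Unset Strict Implicit.
Unset Printing Implicit Defensive.

Import GRing.Theory.
Local Open Scope ring_scope.

(** The Paley tournament is doubly regular, and in a doubly regular tournament
    the transitive subtournaments of order 4 can be counted by hand.

    In any digraph without 2-cycles a transitive subtournament has exactly one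
    transitive listing, so transitive subtournaments of order [m] correspond to
    sequences [a_1, ..., a_m] with an arc from [a_i] to [a_j] whenever [i < j]
    ([card_transitive_subtournaments]).  Such a sequence of length 4 consists of
    an arc [x -> y], followed by an arc inside the set of common out-neighbours
    of [x] and [y].  A tournament has exactly [s (s - 1) / 2] arcs inside a set
    of [s] vertices ([card_arcs_in]); so if every vertex has [k] out-neighbours,
    and the two ends of every arc have [t] common out-neighbours, the number of
    sequences is [q k t (t - 1) / 2].

    Counting arcs also determines [k] and [t]: the arcs of the whole tournament
    give [q k = q (q - 1) / 2], and the arcs inside the out-neighbourhood of a
    vertex give [k t = k (k - 1) / 2].  Hence [k = (q - 1) / 2] and
    [t = (q - 3) / 4], and no character sum is needed.

    That [k] and [t] exist for the Paley tournament follows from its affine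
    symmetries [z |-> x + s z], with [s] a nonzero square, which map the arc
    [0 -> 1] to any given arc. *)

(** * Chains of a digraph *)

Section Chains.
Variables (T : finType) (G : rel T).

(** The out-neighbourhood of a vertex. *)
Definition out_nbrs (x : T) : {set T} := [set y | G x y].

(** The listings [a_1, ..., a_m] of vertices of [A] with an arc from [a_i] to
    [a_j] for all [i < j]. *)
Definition chains (m : nat) (A : {set T}) : {set m.-tuple T} :=
  [set a : m.-tuple T | all (mem A) a && pairwise G a].

Lemma card_chains0 (A : {set T}) : #|chains 0 A| = 1%N.
Proof.
rewrite -[RHS](cards1 [tuple of [::] : seq T]); apply: eq_card => a.
by rewrite !inE tuple0 eqxx.
Qed.

(** The first vertex of a chain dominates the rest, which is again a chain. *)
Lemma card_chainsS (m : nat) (A : {set T}) :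
  #|chains m.+1 A| = (\sum_(x in A) #|chains m (A :&: out_nbrs x)|)%N.
Proof.
rewrite -sum1_card.
rewrite (reindex (fun p : T * m.-tuple T => [tuple of p.1 :: p.2])) /=;
  last first.
  exists (fun a : m.+1.-tuple T => (thead a, [tuple of behead a])).
    by case=> x a _ /=; congr pair; apply/val_inj.
  by move=> a _; rewrite [RHS]tuple_eta; apply/val_inj.
under [RHS]eq_bigr => x _ do rewrite -sum1_card.
rewrite pair_big_dep /=; apply: eq_bigl => -[x a] /=; rewrite !inE /=.
have -> : all (mem (A :&: out_nbrs x)) a = all (mem A) a && all (G x) a.
  by rewrite -all_predI; apply: eq_all => y; rewrite /= !inE.
by rewrite -!andbA; case: (x \in A); case: (all (mem A) a).
Qed.

Lemma card_chains1 (A : {set T}) : #|chains 1 A| = #|A|.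
Proof.
rewrite card_chainsS -sum1_card.
by apply: eq_bigr => x _; rewrite card_chains0.
Qed.

(** In a digraph without 2-cycles, a transitive subtournament of order [m] is the
    same thing as a chain of length [m]: its arcs are all the arcs of the digraph
    between its vertices, and these determine its transitive listing. *)
Lemma card_transitive_subtournaments (m : nat) :
  (forall x y, G x y -> ~~ G y x) ->
  num_transitive_subtournaments m G = #|chains m setT|.
Proof.
move=> asymG.
have irrG : irreflexive G.
  by move=> x; apply/negP => Gxx; have := asymG _ _ Gxx; rewrite Gxx.
have antiG : antisymmetric G.
  by move=> x y /andP[Gxy Gyx]; move: (asymG _ _ Gxy); rewrite Gyx.
pose arcs (V : {set T}) :=
  [set xy : T * T | (xy \in setX V V) && G xy.1 xy.2].
pose sub (a : m.-tuple T) : {set T} * {set T * T} :=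
  ([set:: a], arcs [set:: a]).
have pw_uniq (s : seq T) : pairwise G s -> uniq s := pairwise_uniq irrG.
rewrite /num_transitive_subtournaments.
suff -> : transitive_subtournaments m G = sub @: chains m setT.
  apply: card_in_imset => a b; rewrite !inE => /andP[_ pa] /andP[_ pb] [ab _].
  apply/val_inj/(pairwise_eq antiG pa pb)/uniq_perm; try exact: pw_uniq.
  by move=> x; have /setP/(_ x) := ab; rewrite !inE.
apply/setP => -[V E]; rewrite inE /=; apply/idP/imsetP.
  case/and4P => /eqP cV /subsetP sEG /and3P[/subsetP sEV _ /forall_inP totE].
  case/existsP => a /andP[/eqP aV /forallP trE].
  (* An arc between vertices of [V] that [E] omits would have to be reversed in
     [E], hence would lie on a 2-cycle. *)
  have EV : E = arcs V.
    apply/setP => -[x y]; rewrite inE; apply/idP/andP => [Exy | []].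
      by rewrite (sEV _ Exy); have := sEG _ Exy; rewrite inE.
    rewrite inE /= => /andP[xV yV] Gxy.
    have /forall_inP/(_ y yV) := totE x xV.
    rewrite (contraTneq _ Gxy) => [/=|->]; last by rewrite irrG.
    case Eyx : ((y, x) \in E); last by rewrite addbF.
    by move: (sEG _ Eyx) (asymG _ _ Gxy); rewrite inE /= => ->.
  have pa : pairwise G a.
    case: (posnP #|V|) => [V0 | V_gt0].
      by have /size0nil-> : size a = 0%N by rewrite size_tuple V0.
    have x0 := tnth a (Ordinal V_gt0); apply/(pairwiseP x0) => i j.
    rewrite !inE size_tuple => iV jV ij.
    have /forallP/(_ (Ordinal jV))/implyP/(_ ij) := trE (Ordinal iV).
    by move/sEG; rewrite inE /= !(tnth_nth x0).
  have sz : size a == m by rewrite size_tuple cV.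
  exists (Tuple sz).
    by rewrite inE pa andbT; apply/allP => x _; rewrite !inE.
  by rewrite /sub /= aV EV.
case=> a; rewrite inE => /andP[_ pa] [-> ->].
have cV : #|[set:: a]| = m.
  by rewrite cardsE (card_uniqP (pw_uniq _ pa)) size_tuple.
apply/and4P; split; first by rewrite cV.
- by apply/subsetP => -[x y]; rewrite !inE /= => /andP[].
- apply/and3P; split.
  + by apply/subsetP => -[x y]; rewrite !inE /= => /andP[].
  + by apply/forall_inP => x xa; rewrite inE /= irrG andbF.
  apply/forall_inP => x xa; apply/forall_inP => y ya; apply/implyP => xy.
  rewrite !inE in xa ya; rewrite !inE /= xa ya /=.
  (* Two distinct entries of [a] are joined by the arc given by their order. *)
  have /(pairwiseP x) pa' := pa.
  have ia : (index x a < size a)%N by rewrite index_mem.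
  have ja : (index y a < size a)%N by rewrite index_mem.
  case: (ltngtP (index x a) (index y a)) => [ij|ij|ij].
  + have := pa' _ _ ia ja ij; rewrite !nth_index // => Gxy.
    by rewrite Gxy (negbTE (asymG _ _ Gxy)).
  + have := pa' _ _ ja ia ij; rewrite !nth_index // => Gyx.
    by rewrite Gyx (negbTE (asymG _ _ Gyx)).
  by case/eqP: xy; rewrite -(nth_index x xa) ij nth_index.
have sz : size a == #|[set:: a]| by rewrite cV size_tuple.
apply/existsP; exists (Tuple sz); rewrite eqxx /=.
apply/forallP => i; apply/forallP => j; apply/implyP => ij.
have x0 := tnth (Tuple sz) i.
rewrite !inE /= !(tnth_nth x0) /=.
have /= si : (i < size a)%N by rewrite size_tuple -[X in (_ < X)%N]cV.
have /= sj : (j < size a)%N by rewrite size_tuple -[X in (_ < X)%N]cV.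
by rewrite !mem_nth //=; have /(pairwiseP x0)/(_ i j si sj ij) := pa.
Qed.

End Chains.

(** * Doubly regular tournaments *)

Section Tournament.
Variables (T : finType) (G : rel T).
Hypothesis irrG : irreflexive G.
Hypothesis totG : forall x y, x != y -> G x y (+) G y x.

Lemma tournament_asym (x y : T) : G x y -> ~~ G y x.
Proof.
move=> Gxy; have xy : x != y by apply: contraTneq Gxy => ->; rewrite irrG.
by have := totG xy; rewrite Gxy.
Qed.

(** Each pair of distinct vertices of [A] carries exactly one arc. *)
Lemma card_arcs_in (A : {set T}) :
  ((\sum_(x in A) #|A :&: out_nbrs G x|) * 2 = #|A| * #|A|.-1)%N.
Proof.
have -> : (\sum_(x in A) #|A :&: out_nbrs G x| =
           \sum_(x in A) \sum_(y in A) G x y)%N.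
  apply: eq_bigr => x _; rewrite -sum1_card big_mkcond [RHS]big_mkcond /=.
  by apply: eq_bigr => y _; rewrite !inE; case: (y \in A); case: (G x y).
rewrite muln2 -addnn [X in (_ + X)%N]exchange_big -big_split /=.
rewrite -sum_nat_const; apply: eq_bigr => x xA; rewrite -big_split /=.
rewrite (cardsD1 x) xA /= -sum1_card (bigD1 x xA) /= irrG.
rewrite big_mkcond [RHS]big_mkcond; apply: eq_bigr => y _.
rewrite !inE -!topredE /= andbC; case: andP => // -[yx _].
by have := totG yx; case: (G x y); case: (G y x).
Qed.

Lemma card_chains2 (A : {set T}) : (#|chains G 2 A| * 2 = #|A| * #|A|.-1)%N.
Proof.
rewrite card_chainsS -card_arcs_in; congr (_ * _)%N.
by apply: eq_bigr => x _; rewrite card_chains1.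
Qed.

(** [k] and [t] are the parameters of a doubly regular tournament. *)
Variables k t : nat.
Hypothesis outG : forall x, #|out_nbrs G x| = k.
Hypothesis common_outG :
  forall x y, G x y -> #|out_nbrs G x :&: out_nbrs G y| = t.

(** Double counting of all the arcs. *)
Lemma out_degree_regular : (0 < #|T|)%N -> (k * 2 = #|T|.-1)%N.
Proof.
move=> T_gt0; apply/eqP; rewrite -(eqn_pmul2l T_gt0) mulnA -cardsT.
rewrite -card_arcs_in -sum_nat_const; apply/eqP; congr (_ * _)%N.
by apply: eq_bigr => x _; rewrite setTI outG.
Qed.

(** Double counting of the arcs inside the out-neighbourhood of one vertex. *)
Lemma common_out_degree : (0 < #|T|)%N -> (0 < k)%N -> (t * 2 = k.-1)%N.
Proof.
case/card_gt0P => x _ k_gt0; apply/eqP; rewrite -(eqn_pmul2l k_gt0) mulnA.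
rewrite -(outG x) -card_arcs_in -sum_nat_const; apply/eqP; congr (_ * _)%N.
by apply: eq_bigr => y; rewrite inE => /common_outG ->.
Qed.

Lemma card_chains4 : (#|chains G 4 setT| * 2 = #|T| * (k * (t * t.-1)))%N.
Proof.
rewrite card_chainsS big_distrl -cardsT -sum_nat_const /=.
apply: eq_bigr => x _; rewrite setTI card_chainsS big_distrl /=.
rewrite -(outG x) -sum_nat_const; apply: eq_bigr => y.
by rewrite inE => Gxy; rewrite card_chains2 common_outG.
Qed.

End Tournament.

(** * The Paley tournament *)

Section Paley.
Variables (F : finFieldType) (n : nat).
Hypothesis cardF : #|F| = (4 * n + 3)%N.

Lemma paley_irr : irreflexive (@paley F).
Proof. by move=> x; rewrite /paley /nonzero_square subrr eqxx. Qed.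

(** Translation by [1] permutes the summands of [\sum_x x], and changes the sum by
    [#|F|%:R]. *)
Lemma card_natr_eq0 : #|F|%:R = 0 :> F.
Proof.
have : \sum_(x : F) x = \sum_(x : F) (x + 1) by apply: (reindex_inj (addIr 1)).
rewrite big_split /= sumr_const => /eqP.
by rewrite -[X in X == _]addr0 (inj_eq (addrI _)) => /eqP <-.
Qed.

(** A field of odd order does not have characteristic 2. *)
Lemma one_neq_opp1 : 1 != -1 :> F.
Proof.
rewrite -subr_eq0 opprK; apply/eqP => two0.
have := card_natr_eq0; rewrite cardF.
have -> : (4 * n + 3 = 2 * (2 * n + 1) + 1)%N by lia.
by rewrite natrD natrM mulr2n two0 mul0r add0r => /eqP; rewrite oner_eq0.
Qed.

Lemma expf_card_pred (x : F) : x != 0 -> x ^+ (4 * n + 2) = 1.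
Proof.
move=> x0; apply: (mulfI x0); rewrite mulr1 -exprS.
by rewrite -[RHS]expf_card cardF; congr (_ ^+ _); lia.
Qed.

(** Euler's criterion.  If [x] has exponent [2 n + 1], then [x = x ^ (2 n + 2)]
    is visibly a square. *)
Lemma nonzero_squareE (x : F) : nonzero_square x = (x ^+ (2 * n + 1) == 1).
Proof.
apply/idP/eqP => [/andP[x0 /existsP[y /eqP xy]] | x1].
  have y0 : y != 0 by apply: contraNneq x0 => y0; rewrite xy y0 expr0n.
  by rewrite xy -exprM -[RHS](expf_card_pred y0); congr (_ ^+ _); lia.
apply/andP; split.
  by apply: contra_eq_neq x1 => ->; rewrite addn1 expr0n eq_sym oner_neq0.
apply/existsP; exists (x ^+ n.+1); rewrite -exprM.
have -> : (n.+1 * 2 = (2 * n + 1).+1)%N by lia.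
by rewrite exprS x1 mulr1.
Qed.

Lemma nonzero_squareM (s x : F) :
  nonzero_square s -> nonzero_square (s * x) = nonzero_square x.
Proof. by rewrite !nonzero_squareE exprMn => /eqP->; rewrite mul1r. Qed.

(** Since [z ^ (2 n + 1)] is [1] or [-1] and [2 n + 1] is odd, exactly one of [z]
    and [- z] is a square. *)
Lemma paley_tot (x y : F) : x != y -> paley x y (+) paley y x.
Proof.
move=> xy; rewrite /paley -[x - y]opprB !nonzero_squareE.
set z := y - x; have z0 : z != 0 by rewrite subr_eq0 eq_sym.
rewrite exprNn -signr_odd oddD oddM /= expr1 mulN1r eqr_oppLR.
have : z ^+ (2 * n + 1) ^+ 2 == 1.
  by rewrite -exprM -(expf_card_pred z0); apply/eqP; congr (_ ^+ _); lia.
rewrite sqrf_eq1 => /orP[]/eqP->; rewrite eqxx ?(negbTE one_neq_opp1) //.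
by rewrite eq_sym (negbTE one_neq_opp1).
Qed.

(** The map [z |-> x + s z] is an automorphism when [s] is a nonzero square. *)
Lemma paley_affine (x s y z : F) : nonzero_square s ->
  paley (x + s * y) (x + s * z) = paley y z.
Proof.
move=> sq.
by rewrite /paley [- (_ + _)]opprD addrACA subrr add0r -mulrBr nonzero_squareM.
Qed.

Lemma affine_inj (x s : F) : s != 0 -> injective (fun z => x + s * z).
Proof. by move=> s0 y z /addrI/(mulfI s0). Qed.

Lemma nonzero_square1 : nonzero_square (1 : F).
Proof. by rewrite nonzero_squareE expr1n. Qed.

(** Translation by [x] maps [0] to [x]. *)
Lemma paley_out_degree (x : F) :
  #|out_nbrs (@paley F) x| = #|out_nbrs (@paley F) 0|.
Proof.
rewrite -(card_preimset _ (@affine_inj x 1 (oner_neq0 _))).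
apply: eq_card => z; rewrite !inE.
by rewrite -[in RHS](paley_affine x _ _ nonzero_square1) mulr0 addr0.
Qed.

(** The automorphism [z |-> x + (y - x) z] maps the arc [0 -> 1] to [x -> y]. *)
Lemma paley_common_out_degree (x y : F) : paley x y ->
  #|out_nbrs (@paley F) x :&: out_nbrs (@paley F) y| =
  #|out_nbrs (@paley F) 0 :&: out_nbrs (@paley F) 1|.
Proof.
move=> xy; have /andP[s0 _] := xy.
rewrite -(card_preimset _ (affine_inj (x := x) s0)).
apply: eq_card => z; rewrite !inE.
rewrite -[in RHS](paley_affine x 0 z xy) -[in RHS](paley_affine x 1 z xy).
by rewrite mulr0 addr0 mulr1 [x + (y - x)]addrC subrK.
Qed.

Lemma paley_num_transitive4 :
  (num_transitive_subtournaments 4 (@paley F) * 2 =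
   (4 * n + 3) * ((2 * n + 1) * (n * n.-1)))%N.
Proof.
rewrite card_transitive_subtournaments; last first.
  exact: tournament_asym paley_irr paley_tot.
have F_gt0 : (0 < #|F|)%N by rewrite cardF addn3.
have Ek := out_degree_regular paley_irr paley_tot paley_out_degree F_gt0.
have {}Ek : #|out_nbrs (@paley F) 0| = (2 * n + 1)%N.
  by move: Ek; rewrite cardF; lia.
have Et := common_out_degree paley_irr paley_tot paley_out_degree
             paley_common_out_degree F_gt0.
rewrite Ek in Et.
have {}Et : #|out_nbrs (@paley F) 0 :&: out_nbrs (@paley F) 1| = n by lia.
rewrite (card_chains4 paley_irr paley_tot paley_out_degree
           paley_common_out_degree).
by rewrite Ek Et cardF.
Qed.

End Paley.

Theorem corollary2p3 (q : nat) (F : finFieldType) (hF : #|F| = q)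
    (hq : q = 3 %[mod 4]) :
  (num_transitive_subtournaments 4 (@paley F))%:R =
    q%:R * (q%:R - 1) * (q%:R - 3) * (q%:R - 7) / 2 ^+ 6 :> rat.
Proof.
have [n qE] : exists n, q = (4 * n + 3)%N.
  by exists (q %/ 4)%N; rewrite {1}(divn_eq q 4) hq mulnC.
have /(congr1 (fun i => i%:R : rat)) /= :=
  paley_num_transitive4 (etrans hF qE).
rewrite qE; move: (num_transitive_subtournaments _ _) => N.
(* The truncated predecessor is harmless: [n * n.-1 = n * (n - 1)] at [n = 0]. *)
have predE : (n * n.-1)%:R = n%:R * (n%:R - 1) :> rat.
  by case: n {qE} => [|n]; rewrite ?mul0r // natrM -[in RHS]natr1 addrK natr1.
rewrite [in X in _ = X]natrM [in X in _ = X]natrM predE !natrD !natrM.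
by lra.
Qed.
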